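(* Consider the averaged phase oscillator network $\dot\theta_k=\omega+\varepsilon\sum_{j=1}^N\mathrm{h}(\theta_j-\theta_k)$, $\theta_k\in\mathbb{T}$, with coupling function $$\mathrm{h}(\vartheta)=\frac{1}{2\pi}\int_0^{2\pi}\widehat{Z}(\vartheta+s)\,\hat{\mathrm{g}}^{\mathrm{in}}(s)\,\mathrm{d}s ,$$ where $\widehat Z,\hat{\mathrm{g}}^{\mathrm{in}}:\mathbb{T}\to\mathbb{R}$ are the combined phase response and the input function. Suppose that the zero sets $\mathrm{N}(\widehat Z)$ and $\mathrm{N}(\hat{\mathrm{g}}^{\mathrm{in}})$ contain intervals of length $L_1>0$ and $L_2>0$, respectively. If $L_1+L_2>2\pi$, then there is a nontrivial (that is, nonempty) dead zone for $\mathrm{h}$ with length at least $L_1+L_2-2\pi>0$.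
   Context: $\mathbb{T}=\mathbb{R}/2\pi\mathbb{Z}$. $\mathrm{N}(F)=\{x : F(x)=0\}$ denotes the zero set of a function $F$. The setting is the averaged phase reduction of a network of weakly coupled limit cycle oscillators whose coupling acts in only one variable and is separable, $\hat{\mathrm{g}}(\theta_j,\theta_k)=\hat{\mathrm{g}}^{\mathrm{in}}(\theta_j)\,\hat{\mathrm{g}}^{\mathrm{res}}(\theta_k)$ in terms of phases on the limit cycle; $\widehat Z(\vartheta)=Z(\vartheta)\hat{\mathrm{g}}^{\mathrm{res}}(\vartheta)$ with $Z$ the corresponding component of the phase response curve (the gradient of the asymptotic phase on the limit cycle). Intervals in $\mathbb{T}$ are arcs, of length at most $2\pi$. A dead zone of $\mathrm{h}$ is a maximal connected open set of $\vartheta\in\mathbb{T}$ on which $\mathrm{h}=0$; its length is its length as a subset of the circle $\mathbb{T}$ of total length $2\pi$. *)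

(* Defs.v *)
From HB Require Import structures.
From mathcomp Require Import all_boot all_order all_algebra.
From mathcomp Require Import all_classical all_reals all_analysis.

Set Implicit Arguments.
Unset Strict Implicit.
Unset Printing Implicit Defensive.

Import Order.TTheory GRing.Theory Num.Theory.
Import numFieldNormedType.Exports.

Local Open Scope classical_set_scope.
Local Open Scope ring_scope.

Definition two_pi_int (R : realType) : {pred R} :=
  fun x => x / (2 * pi) \is a Num.int.

Lemma two_pi_int_zmod_closed (R : realType) : zmod_closed (two_pi_int (R := R)).
Proof.
split=> [|x y]; rewrite -!topredE /=; first by rewrite /two_pi_int mul0r rpred0.
by move=> hx hy; rewrite /two_pi_int mulrBl rpredB.
Qed.

HB.instance Definition _ (R : realType) :=
  GRing.isZmodClosed.Build R (two_pi_int (R := R)) (two_pi_int_zmod_closed R).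

(* The circle R / 2 pi Z, with the quotient topology and the quotient group
   structure. *)
Definition circle (R : realType) : Type :=
  quotient_topology (Quotient.quot (two_pi_int (R := R))).

HB.instance Definition _ (R : realType) := Topological.on (circle R).
HB.instance Definition _ (R : realType) :=
  GRing.Zmodule.copy (circle R) (Quotient.quot (two_pi_int (R := R))).

Definition to_circle (R : realType) (x : R) : circle R :=
  (\pi_(Quotient.quot (two_pi_int (R := R))) x)%qT.

Section Circle.
Variable R : realType.
Implicit Types (A D : set (circle R)) (F h : circle R -> R).

(* The Lebesgue measure of A read in the fundamental domain [0, 2 pi[ (the
   total length of the circle is 2 pi). *)
Definition circle_length A : \bar R :=
  lebesgue_measure ((@to_circle R) @^-1` A `&` `[0, 2 * pi[).

(* An interval of the circle is the image of a real interval of any kind; in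
   particular its [circle_length] never exceeds 2 pi. *)
Definition is_arc A : Prop :=
  exists i : interval R, A = (@to_circle R) @` [set` i].

Definition zero_set F : set (circle R) := [set x | F x = 0].

Definition contains_arc_of_length A (L : R) : Prop :=
  exists2 I, is_arc I /\ circle_length I = L%:E & I `<=` A.

Definition dead_zone_candidate h D : Prop :=
  [/\ open D, connected D & D `<=` zero_set h].

(* The empty set is a candidate: it is a dead zone exactly when there is no
   nonempty one, so nonemptiness has to be asserted separately. *)
Definition dead_zone h D : Prop :=
  dead_zone_candidate h D /\
  forall D', dead_zone_candidate h D' -> D `<=` D' -> D' = D.

(* Lebesgue integral; no regularity of Zhat and gin is built in. *)
Definition coupling (Zhat gin : circle R -> R) (theta : circle R) : R :=
  (2 * pi)^-1 *
  \int[lebesgue_measure]_(s in `[0, 2 * pi])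
     (Zhat (theta + to_circle s) * gin (to_circle s)).

End Circle.

(* Main.v *)
(* If Zhat vanishes on the open arc ]a, a + L1[ and gin on ]b, b + L2[, then
   for t in ]a - b - L2, a - b + L1 - 2 pi[ the translate by t of the
   complement of the second arc lies inside the first one, so the integrand
   defining the coupling vanishes identically. These t form an open arc of
   length L1 + L2 - 2 pi; the dead zone is the union of all connected open
   zero sets through one of its points. *)
Require Import Defs.
From HB Require Import structures.
From mathcomp Require Import all_boot all_order all_algebra.
From mathcomp Require Import all_classical all_reals all_analysis.
From mathcomp Require Import lra.

Set Implicit Arguments.
Unset Strict Implicit.
Unset Printing Implicit Defensive.

Import Order.TTheory GRing.Theory Num.Theory.
Import numFieldNormedType.Exports.

Local Open Scope classical_set_scope.
Local Open Scope ring_scope.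

Lemma to_circle_eqP (R : realType) (x y : R) :
  to_circle x = to_circle y <-> exists k : int, y = x + k%:~R * (2 * pi).
Proof.
have pi2 : (2 * pi : R) != 0 by rewrite mulf_neq0 ?pnatr_eq0 ?gt_eqF ?pi_gt0.
have modE := Quotient.idealrBE (two_pi_int (R := R)) y x.
have modP : to_circle x = to_circle y <-> y - x \in two_pi_int (R := R).
  rewrite modE; split=> [xy|/eqP yx]; last exact: esym yx.
  by apply/eqP; exact: esym xy.
split=> [/modP/intrP[k hk]|[k yE]].
  by exists k; rewrite -hk divfK // addrC subrK.
by apply/modP/intrP; exists k; rewrite yE addrAC subrr add0r mulfK.
Qed.

Lemma to_circleD (R : realType) (x y : R) :
  to_circle (x + y) = to_circle x + to_circle y.
Proof. exact: (Quotient.pi_add (two_pi_int (R := R)) x y). Qed.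

Lemma to_circle_translate (R : realType) (k : int) (x : R) :
  to_circle (x + k%:~R * (2 * pi)) = to_circle x.
Proof. by apply/esym/to_circle_eqP; exists k. Qed.

Lemma to_circle_repr_from (R : realType) (a x : R) :
  exists2 k : int,
    a <= x + k%:~R * (2 * pi) & x + k%:~R * (2 * pi) < a + 2 * pi.
Proof.
have pi0 : (0 : R) < 2 * pi by rewrite mulr_gt0 ?pi_gt0.
have := floor_itv ((x - a) / (2 * pi)); set m := Num.floor _.
rewrite ler_pdivlMr // ltr_pdivrMr // intrD => /andP[h1 h2].
by exists (- m); rewrite mulrNz mulNr; lra.
Qed.

(** The window leaves only the multiples [0] and [1] of the period. It is wide enough to compare a
    point of the fundamental domain with an arc that runs past [2 * pi] once. *)
Lemma to_circle_eq_near (R : realType) (x y : R) :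
  - (2 * pi) < y - x < 2 * (2 * pi) -> to_circle x = to_circle y ->
  y = x \/ y = x + 2 * pi.
Proof.
have pi0 : (0 : R) < 2 * pi by rewrite mulr_gt0 ?pi_gt0.
move=> /andP[h1 h2] /to_circle_eqP[k yE].
have : k%:~R < 2%:~R :> R by rewrite -(ltr_pM2r pi0); lra.
have : (-1)%:~R < k%:~R :> R by rewrite -(ltr_pM2r pi0); lra.
rewrite !ltr_int => k1 k2.
have [k0|k0] : k = 0 \/ k = 1 by move: k k1 k2 {yE} => [[|[|[|n]]]|[|n]]; auto.
- by left; rewrite yE k0 mul0r addr0.
- by right; rewrite yE k0 mul1r.
Qed.

Lemma le_lebesgue_measure (R : realType) (A B : set R) :
  A `<=` B -> (lebesgue_measure A <= lebesgue_measure B)%E.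
Proof.
(* [lebesgue_measure] unfolds to an outer measure, monotone on all sets. *)
move=> AB; rewrite /lebesgue_measure /lebesgue_stieltjes_measure.
by rewrite /measure_extension; exact: le_outer_measure.
Qed.

Lemma lebesgue_measure_bounded_itv (R : realType) (b c : bool) (x y : R) :
  x <= y ->
  lebesgue_measure ([set` Interval (BSide b x) (BSide c y)] : set R) =
    (y - x)%:E.
Proof.
rewrite le_eqVlt lebesgue_measure_itv /= lte_fin => /predU1P[->|->//].
by rewrite ltxx subrr.
Qed.

Lemma le_circle_length (R : realType) (A B : set (circle R)) :
  A `<=` B -> (circle_length A <= circle_length B)%E.
Proof.
by move=> AB; apply: le_lebesgue_measure => x [/AB].
Qed.

Lemma circle_length_le2pi (R : realType) (A : set (circle R)) :
  (circle_length A <= (2 * pi)%:E)%E.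
Proof.
have pi0 : (0 : R) < 2 * pi by rewrite mulr_gt0 ?pi_gt0.
apply: (@le_trans _ _ (lebesgue_measure (`[0, 2 * pi[ : set R))).
  by apply: le_lebesgue_measure => x [].
by rewrite lebesgue_measure_bounded_itv ?subr0// ltW.
Qed.

(** Past one full turn the bound is trivial. Otherwise, with [a] moved into the fundamental domain,
    the segment wraps at most once, so two segments of total length [b - a] cover its trace
    there. *)
Lemma circle_length_segment_le (R : realType) (a b : R) :
  a <= b -> (circle_length (@to_circle R @` `[a, b]) <= (b - a)%:E)%E.
Proof.
have pi0 : (0 : R) < 2 * pi by rewrite mulr_gt0 ?pi_gt0.
have [ba _|ab2 ab] := leP (2 * pi) (b - a).
  by rewrite (le_trans (circle_length_le2pi _)) ?lee_fin.
have [k] := to_circle_repr_from 0 a.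
set a0 := a + _ => a00 a02; pose b0 := b + k%:~R * (2 * pi).
have -> : b - a = b0 - a0 by rewrite /b0 /a0; lra.
have b0a0 : a0 <= b0 by rewrite lerD2r.
(* Cut at [2 * pi]: [[a0, m]] is the part before it, [[0, n]] the part after it moved back one turn,
   a single point if nothing wraps. *)
pose m : R := Num.min b0 (2 * pi); pose n : R := Num.max 0 (b0 - 2 * pi).
have mn : m - a0 + n = b0 - a0 /\ a0 <= m /\ 0 <= n.
  rewrite /m /n; case: (leP b0) => ?; case: (leP 0 (_ - _)) => ?;
  by do !split; lra.
have : (lebesgue_measure (`[a0, m] `|` `[0%R, n] : set R) <= (b0 - a0)%:E)%E.
  apply: (le_trans (measureU2 _ _ _)) => //.
  have [<- [am n0]] := mn; rewrite EFinD.
  by apply: leeD; rewrite [leLHS]lebesgue_measure_bounded_itv ?subr0.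
apply: le_trans; apply: le_lebesgue_measure => x [[y /=]].
rewrite in_itv/= => /andP[ay yb].
rewrite -(to_circle_translate k) => /esym xy; rewrite in_itv/= => /andP[x0 x2].
have [] := to_circle_eq_near _ xy; first by rewrite /a0 /b0 in a00 a02 *; lra.
  move=> yx; left; rewrite /= in_itv /= /m le_min.
  by rewrite /a0 /b0 -yx; lra.
move=> yx; right; rewrite /= in_itv /= /n le_max.
by rewrite x0 /b0 /=; apply/orP; right; lra.
Qed.

(* The interval either contains an open interval of length L or sits in a
   segment shorter than L, which is too short to cover an arc of length L. *)
Lemma arc_contains_open_arc (R : realType) (A : set (circle R)) (L : R) :
  0 < L -> contains_arc_of_length A L ->
  exists a, @to_circle R @` `]a, a + L[ `<=` A.
Proof.
move=> L0 [I [[i ->] lenI] IA].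
have [[a ai]|[a [b [ab bL iab]]]] : (exists a, `]a, a + L[ `<=` [set` i]) \/
    exists a b, [/\ a <= b, b - a < L & [set` i] `<=` `[a, b]].
(* Intervals with left bound +oo or right bound -oo are empty and fit in [[0, 0]]. *)
- case: i {lenI IA} => -[bl x|[]] -[br y|[]];
    try by right; exists 0, 0; split; rewrite ?subrr// => z /=;
      rewrite itv_boundlr /= ?andbF.
  + have [xyL|xyL] := leP (x + L) y.
      left; exists x => z /=; rewrite !itv_boundlr /= !(bnd_simp, leBSide).
      by move=> /andP[xz zx]; rewrite !lteifS //; lra.
    (* The maximum covers reversed bounds [y < x], where the interval is empty. *)
    right; exists x, (Num.max x y); split; first by rewrite le_max lexx.
      by case: (leP x y) => ?; lra.
    move=> z /=; rewrite !itv_boundlr /= !(bnd_simp, leBSide).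
    by move=> /andP[/lteifW xz /lteifW zy]; rewrite xz le_max zy orbT.
  + left; exists x => z /=; rewrite !itv_boundlr /= !(bnd_simp, leBSide).
    by move=> /andP[xz _]; rewrite lteifS.
  + left; exists (y - L) => z /=; rewrite !itv_boundlr /= !(bnd_simp, leBSide).
    by move=> /andP[_ zx]; rewrite lteifS//; lra.
  + by left; exists 0 => z /=; rewrite !itv_boundlr.
- by exists a; apply: subset_trans IA; exact: image_subset.
- have := le_circle_length (@image_subset _ _ (@to_circle R) _ _ iab).
  rewrite lenI => /le_trans/(_ (circle_length_segment_le ab)).
  by rewrite lee_fin leNgt bL.
Qed.

Lemma to_circle_continuous (R : realType) : continuous (@to_circle R).
Proof. exact: pi_continuous. Qed.

Lemma open_preimage_to_circle (R : realType) (D : set (circle R)) :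
  open D = open (@to_circle R @^-1` D).
Proof. by []. Qed.

(** The preimage of the image is the union of the translates of [U] by all periods, each of them
    open. *)
Lemma open_to_circle_image (R : realType) (U : set R) :
  open U -> open (@to_circle R @` U).
Proof.
move=> oU; rewrite open_preimage_to_circle.
have -> : @to_circle R @^-1` (@to_circle R @` U) =
    \bigcup_k (fun x => x + k%:~R * (2 * pi)) @^-1` U.
  apply/seteqP; split=> [x [y Uy /esym/to_circle_eqP[k yE]]|x [k _ Ux]].
    by exists k => //=; rewrite -yE.
  by exists (x + k%:~R * (2 * pi)) => //; rewrite to_circle_translate.
apply: bigcup_open => k _; apply: open_comp => // x _.
by apply: cvgD; [exact: cvg_id|exact: cvg_cst].
Qed.

Lemma connected_to_circle_itv (R : realType) (i : interval R) :
  connected (@to_circle R @` [set` i]).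
Proof.
apply: connected_continuous_connected.
  by apply/connected_intervalP; exact: interval_is_interval.
by apply: continuous_subspaceT; exact: to_circle_continuous.
Qed.

(** Same cut at [2 * pi] as for segments. Since [l <= 2 * pi], the wrapped piece stops at or before
    [a0], so the pieces are disjoint and their lengths add up. *)
Lemma circle_length_open_arc_ge (R : realType) (a l : R) :
  0 < l <= 2 * pi ->
  (l%:E <= circle_length (@to_circle R @` `]a, (a + l)%R[))%E.
Proof.
move=> /andP[l0 l2].
have [k] := to_circle_repr_from 0 a.
set a0 := a + _ => a00 a02.
pose m : R := Num.min (a0 + l) (2 * pi).
pose n : R := Num.max 0 (a0 + l - 2 * pi).
have mn : m - a0 + n = l /\ a0 < m /\ 0 <= n <= a0.
  rewrite /m /n; case: (leP (a0 + l)) => ?; case: (leP 0 (_ - _)) => ?;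
  by do !split; lra.
(* The second piece may include [0]: if it is nonempty, [2 * pi] is interior to the translated
   arc. *)
have <- : lebesgue_measure (`]a0, m[ `|` `[0%R, n[ : set R) = l%:E.
  rewrite measureU //; last first.
    apply/seteqP; split=> // x [] /=; rewrite !in_itv/=; lra.
  have [ma n0] : a0 <= m /\ 0 <= n by lra.
  rewrite [X in (X + _)%E]lebesgue_measure_bounded_itv//.
  rewrite [X in (_ + X)%E]lebesgue_measure_bounded_itv//.
  by rewrite -EFinD; congr EFin; lra.
apply: le_lebesgue_measure => x [] /=; rewrite !in_itv /=.
  rewrite lt_min => /andP[ax /andP[xl x2]]; split; last by rewrite x2; lra.
  exists (x - k%:~R * (2 * pi)).
    by rewrite /= in_itv /= /a0 in ax xl *; lra.
  by rewrite -(to_circle_translate k) subrK.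
move=> /andP[x0]; rewrite lt_max => /orP[|xl]; first by lra.
split; last by lra.
exists (x + 2 * pi - k%:~R * (2 * pi)).
  by rewrite /= in_itv /= /a0 in a00 a02 xl *; lra.
rewrite -(to_circle_translate k) subrK.
by rewrite -[2 * pi]mul1r (to_circle_translate 1).
Qed.

Lemma dead_zone_exists (R : realType) (h : circle R -> R) (C : set (circle R)) :
  C !=set0 -> dead_zone_candidate h C ->
  exists2 D, dead_zone h D & C `<=` D.
Proof.
move=> [x Cx] candC.
pose F := [set E | dead_zone_candidate h E /\ E x].
exists (\bigcup_(E in F) E); last by move=> y Cy; exists C.
split; first split.
- by apply: bigcup_open => E [[]].
- by apply: bigcup_connected => [|E [[]]//]; exists x => E [].
- by move=> y [E [[_ _ Eh] _] /Eh].
(* A candidate containing the union contains [C], hence [x], and so is itself a member of [F]. *)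
- move=> D candD FD; apply/seteqP; split=> // y Dy.
  by exists D => //; split=> //; apply: FD; exists C.
Qed.

(** The lower bound on [t] sends [b + L2] beyond [a]; the upper bound sends [b + 2 * pi] short of
    [a + L1]. Reducing [- s] instead of [s] gives a window open at [b], a point that the open arc
    omits. *)
Lemma coupling_eq0 (R : realType) (Zhat gin : circle R -> R) (a b L1 L2 t : R) :
  @to_circle R @` `]a, a + L1[ `<=` zero_set Zhat ->
  @to_circle R @` `]b, b + L2[ `<=` zero_set gin ->
  a - b - L2 < t < a - b + L1 - 2 * pi ->
  coupling Zhat gin (to_circle t) = 0.
Proof.
move=> Z0 g0 /andP[ht1 ht2]; rewrite /coupling.
suff zero s : Zhat (to_circle t + to_circle s) * gin (to_circle s) = 0.
  by under eq_Rintegral do rewrite zero; rewrite Rintegral_cst// mul0r mulr0.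
(* Here - r is the representative of s in ]b, b + 2 pi]; if it misses
   ]b, b + L2[, then t - r lies in ]a, a + L1[. *)
have [k] := to_circle_repr_from (- b - 2 * pi) (- s).
set r := - s + _ => hr1 hr2.
have -> : to_circle s = to_circle (- r).
  by apply/to_circle_eqP; exists (- k); rewrite /r mulrNz; lra.
have [rL|rL] := ltP (- r) (b + L2).
  by rewrite g0 ?mulr0//; exists (- r) => //; rewrite /= in_itv /=; lra.
rewrite -to_circleD Z0 ?mul0r//; exists (t - r) => //.
by rewrite /= in_itv /=; lra.
Qed.

Theorem proposition3 (R : realType) (Zhat gin : circle R -> R) (L1 L2 : R)
  (L1_gt0 : 0 < L1) (L2_gt0 : 0 < L2)
  (Zhat_arc : contains_arc_of_length (zero_set Zhat) L1)
  (gin_arc : contains_arc_of_length (zero_set gin) L2)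
  (L12 : 2 * pi < L1 + L2) :
  exists D : set (circle R),
    [/\ dead_zone (coupling Zhat gin) D,
        D !=set0,
        ((L1 + L2 - 2 * pi)%:E <= circle_length D)%E
      & 0 < L1 + L2 - 2 * pi].
Proof.
(* This gives [l <= 2 * pi] below, as the lower bound on the length of [C] requires. *)
have le2pi A L : contains_arc_of_length A L -> L <= 2 * pi :> R.
  by move=> [I [_ lenI] _]; rewrite -lee_fin -lenI circle_length_le2pi.
have L1_le := le2pi _ _ Zhat_arc; have L2_le := le2pi _ _ gin_arc.
have [a Z0] := arc_contains_open_arc L1_gt0 Zhat_arc.
have [b g0] := arc_contains_open_arc L2_gt0 gin_arc.
pose l := L1 + L2 - 2 * pi; have l0 : 0 < l by rewrite subr_gt0.
(* Here [c + l = a - b + L1 - 2 * pi], so []c, c + l[] is exactly the range of [t] in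
   [coupling_eq0]. *)
pose c := a - b - L2; pose C := @to_circle R @` `]c, c + l[.
have C0 : C !=set0.
  by exists (to_circle (c + l / 2)), (c + l / 2) => //=; rewrite in_itv /=; lra.
have candC : dead_zone_candidate (coupling Zhat gin) C.
  split; first by apply: open_to_circle_image; exact: interval_open.
    exact: connected_to_circle_itv.
  move=> _ [t + <-]; rewrite /= in_itv /= => tc; apply: coupling_eq0 Z0 g0 _.
  by rewrite /c /l in tc; lra.
have [D deadD CD] := dead_zone_exists C0 candC.
exists D; split=> //; first by case: C0 => x /CD; exists x.
apply: le_trans (le_circle_length CD); apply: circle_length_open_arc_ge.
by rewrite /l in l0 *; lra.
Qed.
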